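(* Let $L$ be a finite-dimensional Leibniz algebra over an infinite field. Then $L$ is cyclic if and only if it has only finitely many maximal subalgebras.
   Context: A (right) Leibniz algebra over a field $F$ is an $F$-vector space $L$ with a bilinear product $[\cdot,\cdot]$ satisfying $[x,[y,z]]=[[x,y],z]-[[x,z],y]$ for all $x,y,z\in L$. $L$ is called cyclic if it is generated, as a Leibniz algebra, by a single element. A maximal subalgebra is a proper subalgebra not properly contained in another proper subalgebra. *)

(* Defs.v *)
From HB Require Import structures.
From mathcomp Require Import all_boot all_order all_algebra.
From mathcomp Require Import boolp classical_sets functions cardinality.

Set Implicit Arguments.
Unset Strict Implicit.
Unset Printing Implicit Defensive.

Import GRing.Theory.
Local Open Scope classical_set_scope.
Local Open Scope ring_scope.

(* A finite-dimensional Leibniz algebra is a [vectType] over a field together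
   with a bilinear product [br] satisfying the right Leibniz identity. *)
Definition right_leibniz (F : fieldType) (L : vectType F)
    (br : L -> L -> L) : Prop :=
  forall x y z : L, br x (br y z) = br (br x y) z - br (br x z) y.

Definition subalgebra (F : fieldType) (L : vectType F) (br : L -> L -> L)
    (U : {vspace L}) : Prop :=
  forall x y : L, x \in U -> y \in U -> br x y \in U.

Definition generated_subalgebra (F : fieldType) (L : vectType F)
    (br : L -> L -> L) (A : set L) : set L :=
  \bigcap_(U in [set U : {vspace L} | subalgebra br U /\ A `<=` [set` U]])
    [set` U].

Definition cyclic_algebra (F : fieldType) (L : vectType F)
    (br : L -> L -> L) : Prop :=
  exists x : L, generated_subalgebra br [set x] = [set: L].

Definition proper_subalgebra (F : fieldType) (L : vectType F)
    (br : L -> L -> L) (U : {vspace L}) : Prop :=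
  subalgebra br U /\ U <> fullv.

Definition maximal_subalgebra (F : fieldType) (L : vectType F)
    (br : L -> L -> L) (M : {vspace L}) : Prop :=
  proper_subalgebra br M /\
  ~ (exists U : {vspace L},
       [/\ proper_subalgebra br U, (M <= U)%VS & M <> U]).

(* Main.v *)
Require Import Defs.
From mathcomp Require Import all_boot all_order all_algebra.
From mathcomp Require Import boolp classical_sets functions cardinality.

(** Suppose that [a] generates [L] and let [K] be the space of all [z] with
    [br x z = 0] for every [x].  The Leibniz identity, read as the rule that
    right multiplication by [br y z] is a commutator of right multiplications,
    puts both [br a a] and every [br k a] with [k] in [K] back into [K].  Hence
    the sum of the line of [a] and [K] is a subalgebra containing [a], so it is
    all of [L] ([cyclic_line_annihilator]), and the product collapses to
    [br u (c *: a + k) = c *: T u] where [T] is right multiplication by [a].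

    A subalgebra that is not inside [K] is therefore stable under [T], while a
    maximal one inside [K] equals [K] (unless [K] is everything, when [T] is
    zero and stability is automatic).  Conversely every [T]-stable subspace is
    a subalgebra, so [a] is a cyclic vector for [T].  Then [L] is a cyclic
    module over the polynomial ring, annihilated by some nonzero [m], and its
    [T]-stable subspaces are governed by the monic divisors of [m], which are
    finite in number ([finite_stable_subspaces], [finite_monic_divisors]).

    For the other direction, finitely many proper subspaces cannot cover [L]
    over an infinite field ([avoid_finite_subspaces]), so some [x] lies in no
    maximal subalgebra.  Since dimension is bounded, each proper subalgebra is
    contained in a maximal one ([proper_subalgebra_maximal]); hence no proper
    subalgebra contains [x], that is, [x] generates [L]. *)

Local Open Scope classical_set_scope.
Local Open Scope ring_scope.

Set Implicit Arguments.
Unset Strict Implicit.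

Import GRing.Theory.

(** * Divisors and ideals of univariate polynomials *)

Lemma monic_normalize (F : fieldType) (p : {poly F}) :
  p != 0 -> (lead_coef p)^-1 *: p \is monic.
Proof.
by move=> p0; rewrite monicE lead_coefZ mulVf // lead_coef_eq0.
Qed.

(** A nonconstant divisor of least size has no smaller nonconstant divisor. *)
Lemma monic_irreducible_factor (F : fieldType) (m : {poly F}) :
  (1 < size m)%N ->
  exists p : {poly F}, [/\ p \is monic, irreducible_poly p & p %| m].
Proof.
move=> m1.
pose P n := `[< exists p : {poly F}, [/\ size p = n, (1 < n)%N & p %| m] >].
have exP : exists n, P n.
  by exists (size m); apply/asboolP; exists m; rewrite dvdpp.
case: (ex_minnP exP) => n /asboolP[p [sp n1 pm]] minn.
have p0 : p != 0 by rewrite -size_poly_gt0 sp ltnW.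
have c0 : (lead_coef p)^-1 != 0 by rewrite invr_eq0 lead_coef_eq0.
exists ((lead_coef p)^-1 *: p).
split; [exact: monic_normalize | split | by rewrite dvdpZl].
  by rewrite size_scale ?sp.
move=> q q1; rewrite dvdpZr // => qp.
rewrite (eqp_rtrans (eqp_scale _ c0)) -(dvdp_size_eqp qp) eqn_leq.
rewrite dvdp_leq //= sp minn //; apply/asboolP; exists q; split => //.
  rewrite ltn_neqAle eq_sym q1 size_poly_gt0.
  by apply: contraNneq p0 => q0; rewrite q0 dvd0p in qp.
exact: dvdp_trans qp pm.
Qed.

(** Induction on the size: if [p] is a monic irreducible factor and
    [m = q * p], then a monic divisor of [m] either is coprime to [p], and
    divides [q], or is [p] times a monic divisor of [q]. *)
Lemma finite_monic_divisors (F : fieldType) (m : {poly F}) : m != 0 ->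
  finite_set [set d : {poly F} | d \is monic /\ d %| m].
Proof.
move: {2}(size m) (leqnn (size m)) => n.
elim: n m => [|n IHn] m; first by rewrite leqn0 size_poly_eq0 => ->.
move=> mn m0; have [m1|m1] := leqP (size m) 1%N.
  apply: (sub_finite_set _ (finite_set1 (1 : {poly F}))) => d /= [dmon dm].
  have := leq_trans (dvdp_leq m0 dm) m1.
  move=> /size1_polyC dE; move: dmon.
  by rewrite dE monicE lead_coefC => /eqP ->.
have [p [pmon pirr pm]] := monic_irreducible_factor m1.
have /dvdpP[q mE] := pm.
have q0 : q != 0 by apply: contraNneq m0 => q0; rewrite mE q0 mul0r.
have qn : (size q <= n)%N.
  rewrite -ltnS (leq_trans _ mn) // mE size_Mmonic //.
  case: (size p) pirr.1 => [//|k]; rewrite ltnS => k0.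
  by rewrite addnS /= -[X in (X < _)%N]addn0 ltn_add2l.
have fin_q := IHn q qn q0.
have fin_pq := finite_image (fun d => d * p) fin_q.
apply: (@sub_finite_set _ _ (_ `|` _)); last first.
  by rewrite finite_setU; split; [exact: fin_q | exact: fin_pq].
move=> d /= [dmon dm]; have [/dvdpP[e dE]|pd] := boolP (p %| d).
  right; exists e => //=; split; first by rewrite dE monicMr in dmon.
  by rewrite mE dE dvdp_mul2r ?monic_neq0 in dm.
left; split => //; move: dm; rewrite mE Gauss_dvdpl //.
by rewrite coprimep_sym irreducible_poly_coprime.
Qed.

(** The polynomials over a field form a principal ideal domain: a monic
    element of least size generates, since remainders modulo it stay in the
    ideal. *)
Lemma poly_ideal_generator (F : fieldType) (I : {poly F} -> Prop)
    (m : {poly F}) :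
  (forall p q, I p -> I q -> I (p + q)) -> (forall p q, I q -> I (p * q)) ->
  m != 0 -> I m ->
  exists2 g : {poly F}, g \is monic & forall p, I p <-> g %| p.
Proof.
move=> ID IM m0 Im.
have Inorm p : I p -> I ((lead_coef p)^-1 *: p).
  by rewrite -mul_polyC; exact: IM.
pose P n := `[< exists p : {poly F}, [/\ size p = n, p \is monic & I p] >].
have exP : exists n, P n.
  exists (size ((lead_coef m)^-1 *: m)); apply/asboolP.
  exists ((lead_coef m)^-1 *: m); split=> //; last exact: Inorm.
  exact: monic_normalize.
case: (ex_minnP exP) => n /asboolP[g [sg gmon Ig]] minn.
exists g => // p; split=> [Ip|/dvdpP[q ->]]; last exact: IM.
rewrite /dvdp; apply: contraT; rewrite -/(p %% g == 0) => r0.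
have Ir : I (p %% g).
  have -> : p %% g = p + - (p %/ g) * g.
    by rewrite {2}(divp_eq p g) mulNr addrAC addrN add0r.
  by apply: ID => //; exact: IM.
have : P (size (p %% g)).
  apply/asboolP; exists ((lead_coef (p %% g))^-1 *: (p %% g)).
  rewrite size_scale ?invr_eq0 ?lead_coef_eq0 //.
  by split; [by []|exact: monic_normalize|exact: Inorm].
by move=> /minn; rewrite -sg leqNgt ltn_modp monic_neq0.
Qed.

(** * Stable subspaces of an endomorphism with a cyclic vector *)

(** Passes from a subspace given by a property, such as a kernel condition or
    the image of an infinite-dimensional space, to an element of
    [{vspace L}]; a subspace of largest dimension inside [P] exhausts [P]. *)
Lemma vspace_of_pred (F : fieldType) (L : vectType F) (P : L -> Prop) :
  P 0 -> (forall c u v, P u -> P v -> P (c *: u + v)) ->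
  exists U : {vspace L}, forall v, v \in U <-> P v.
Proof.
move=> P0 Plin.
pose Q n := `[< exists2 U : {vspace L},
  \dim U = n & forall v, v \in U -> P v >].
have exQ : exists n, Q n.
  exists 0%N; apply/asboolP; exists 0%VS; first by rewrite dimv0.
  by move=> v; rewrite memv0 => /eqP ->.
have ubQ n : Q n -> (n <= \dim {:L})%N.
  by move=> /asboolP[U <- _]; rewrite dimvS ?subvf.
case: (ex_maxnP exQ ubQ) => n /asboolP[U dimU UP] maxn.
exists U => v; split=> [|Pv]; first exact: UP.
(* adding v to U keeps it inside P, so maximality of dim U puts v in U *)
have sub : (U <= <[v]> + U)%VS by exact: addvSr.
have /maxn : Q (\dim (<[v]> + U)).
  apply/asboolP; exists (<[v]> + U)%VS => // w /memv_addP[x /vlineP[c ->]].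
  by case=> u uU ->; apply: Plin => //; exact: UP.
rewrite -dimU => le_dim; have /eqP -> : U == (<[v]> + U)%VS.
  by rewrite eqEdim sub.
by rewrite (subvP (addvSl _ _)) // memv_line.
Qed.

Section KrylovEvaluation.
Variables (F : fieldType) (L : vectType F) (T : 'End(L)) (a : L).

(** The value at [a] of the polynomial [p] in the endomorphism [T]. *)
Definition krylov_eval (p : {poly F}) : L :=
  \sum_(i < size p) p`_i *: iter i T a.

Lemma krylov_evalE n (p : {poly F}) : (size p <= n)%N ->
  krylov_eval p = \sum_(i < n) p`_i *: iter i T a.
Proof.
move=> pn; rewrite /krylov_eval.
rewrite (big_ord_widen n (fun i => p`_i *: iter i T a)) //.
rewrite big_mkcond; apply: eq_bigr => i _; case: ltnP => // pi.
by rewrite nth_default // scale0r.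
Qed.

Lemma krylov_evalP c p q :
  krylov_eval (c *: p + q) = c *: krylov_eval p + krylov_eval q.
Proof.
pose n := maxn (size (c *: p + q)) (maxn (size p) (size q)).
rewrite !(@krylov_evalE n) ?leq_max ?leqnn ?orbT //.
rewrite scaler_sumr -big_split; apply: eq_bigr => i _ /=.
by rewrite coefD coefZ scalerDl scalerA.
Qed.

Lemma krylov_evalD p q :
  krylov_eval (p + q) = krylov_eval p + krylov_eval q.
Proof. by have := krylov_evalP 1 p q; rewrite !scale1r. Qed.

Lemma krylov_eval0 : krylov_eval 0 = 0.
Proof. by rewrite /krylov_eval size_poly0 big_ord0. Qed.

Lemma krylov_eval1 : krylov_eval 1 = a.
Proof. by rewrite /krylov_eval size_poly1 big_ord1 coef1 scale1r. Qed.

Lemma krylov_evalMX p : krylov_eval ('X * p) = T (krylov_eval p).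
Proof.
rewrite -commr_polyX (@krylov_evalE (size p).+1).
  rewrite big_ord_recl coefMX scale0r add0r linear_sum; apply: eq_bigr => i _.
  by rewrite coefMX linearZ.
have [->|p0] := eqVneq p 0; first by rewrite mul0r size_poly0.
by rewrite size_mulX.
Qed.

(** A [T]-stable subspace is a submodule over the polynomial ring, so it pulls
    back to an ideal along [krylov_eval]. *)
Lemma krylov_stable_ideal (U : {vspace L}) :
  (forall v, v \in U -> T v \in U) ->
  forall p q, krylov_eval q \in U -> krylov_eval (p * q) \in U.
Proof.
move=> UT p q qU; elim/poly_ind: p => [|p c IHp].
  by rewrite mul0r krylov_eval0 mem0v.
rewrite mulrDl addrC mul_polyC krylov_evalP memvD ?memvZ //.
by rewrite commr_polyX -mulrA krylov_evalMX UT.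
Qed.

(** The iterates of [a] up to the dimension of [L] outnumber that dimension, and
    a linear relation among them is a polynomial killing [a]. *)
Lemma krylov_annihilator : exists2 m : {poly F}, m != 0 & krylov_eval m = 0.
Proof.
pose n := (\dim {:L}).+1; pose X := [tuple iter i T a | i < n].
have nfreeX : ~~ free X.
  apply/negP; rewrite /free size_tuple => /eqP dimX.
  by have := dimvS (subvf <<X>>); rewrite dimX ltnn.
have [k ksum [i ki]] : exists2 k : 'I_n -> F,
    \sum_(i < n) k i *: X`_i = 0 & exists i, k i <> 0.
  apply: contrapT => nex; move/negP: nfreeX; apply; apply/freeP => k ksum i.
  by apply: contrapT => ki; apply: nex; exists k => //; exists i.
pose m := \poly_(j < n) (if insub j is Some i then k i else 0).
have mE (j : 'I_n) : m`_j = k j by rewrite coef_poly ltn_ord valK.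
exists m.
  by apply/eqP => m0; apply: ki; rewrite -mE m0 coef0.
rewrite (@krylov_evalE n) ?size_poly //.
rewrite -[RHS]ksum; apply: eq_bigr => j _.
by rewrite mE (nth_mktuple _ 0).
Qed.

(** The polynomial expressions in [T] applied to [a] form a [T]-stable subspace
    that contains [a]. *)
Lemma krylov_eval_surj :
  (forall U : {vspace L},
     (forall v, v \in U -> T v \in U) -> a \in U -> U = fullv) ->
  forall v, exists p, v = krylov_eval p.
Proof.
move=> cycT v.
have [||U UP] := @vspace_of_pred F L (fun v => exists p, v = krylov_eval p).
- by exists 0; rewrite krylov_eval0.
- by move=> c _ _ [p ->] [q ->]; exists (c *: p + q); rewrite krylov_evalP.
apply/UP; rewrite (cycT U) ?memvf //.
  by move=> w /UP[p ->]; apply/UP; exists ('X * p); rewrite krylov_evalMX.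
by apply/UP; exists 1; rewrite krylov_eval1.
Qed.

(** Surjectivity of [krylov_eval] makes a stable subspace [U] recoverable from
    its preimage ideal, hence from the monic generator [g] of that ideal; and
    [g] divides the annihilator [m], as the preimage of any [U] contains [m]. *)
Lemma finite_stable_subspaces :
  (forall U : {vspace L},
     (forall v, v \in U -> T v \in U) -> a \in U -> U = fullv) ->
  finite_set [set U : {vspace L} | forall v, v \in U -> T v \in U].
Proof.
move=> cycT; have surj := krylov_eval_surj cycT.
have [m m0 ma0] := krylov_annihilator.
pose gen_by (g : {poly F}) (U : {vspace L}) :=
  forall p, krylov_eval p \in U <-> g %| p.
have gen_inj g U V : gen_by g U -> gen_by g V -> U = V.
  move=> gU gV; apply/vspaceP => v; have [p ->] := surj v.
  by apply/idP/idP => [/gU/gV|/gV/gU].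
apply: (sub_finite_set _
  (finite_image (fun g => xget 0%VS (gen_by g)) (finite_monic_divisors m0))).
move=> U /= UT.
have [||||g gmon gU] :=
    @poly_ideal_generator F (fun p => krylov_eval p \in U) m.
- by move=> p q pU qU; rewrite krylov_evalD memvD.
- exact: krylov_stable_ideal.
- exact: m0.
- by rewrite ma0 mem0v.
exists g; first by split=> //; apply/gU; rewrite ma0 mem0v.
by apply: xget_unique => // V gV; exact: gen_inj gV gU.
Qed.

End KrylovEvaluation.

(** * Maximal subalgebras of Leibniz algebras *)

Section Leibniz.
Variables (F : fieldType) (L : vectType F) (br : {bilinear L -> L -> L}).

Lemma right_annihilator_vspace :
  exists K : {vspace L}, forall z, z \in K <-> forall x, br x z = 0.
Proof.
apply: vspace_of_pred => [x|c u v u0 v0 x]; first by rewrite linear0r.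
by rewrite linearPr u0 v0 /= scaler0 addr0.
Qed.

(** The two instances of the Leibniz identity behind closure under the product:
    [br x (br a a)] is a difference of equal terms, and both terms of
    [br x (br k a)] contain a right multiplication by [k]. *)
Lemma cyclic_line_annihilator (K : {vspace L}) (a : L) :
  right_leibniz br -> (forall z, z \in K <-> forall x, br x z = 0) ->
  generated_subalgebra br [set a] = [set: L] -> (<[a]> + K)%VS = fullv.
Proof.
move=> leib KP gena.
suff subA : subalgebra br (<[a]> + K)%VS.
  apply/vspaceP => v; rewrite memvf.
  have : generated_subalgebra br [set a] v by rewrite gena.
  apply; split=> // _ -> /=.
  by rewrite (subvP (addvSl _ _)) // memv_line.
move=> u v /memv_addP[_ /vlineP[c ->] [k kK ->]].
move=> /memv_addP[_ /vlineP[d ->] [l lK ->]].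
rewrite linearDr (KP l).1 // addr0 linearZr_LR /=.
apply/memvZ/(subvP (addvSr _ _)); rewrite linearDl linearZl_LR /=.
apply/memvD; first apply/memvZ.
  by apply/KP => x; rewrite leib subrr.
by apply/KP => x; rewrite leib !(KP k).1 // linear0l subrr.
Qed.

(** A maximal subalgebra is either [K] or stable under right multiplication by
    the generator, which admits finitely many stable subspaces. *)
Lemma finite_maximal_of_cyclic :
  right_leibniz br -> cyclic_algebra br ->
  finite_set [set M : {vspace L} | maximal_subalgebra br M].
Proof.
move=> leib [a gena]; have [K KP] := right_annihilator_vspace.
have aK := cyclic_line_annihilator leib KP gena.
pose T := linfun (applyr br a); have TE v : T v = br v a by rewrite lfunE.
have decomp v : exists c k, k \in K /\ v = c *: a + k.
  have : v \in (<[a]> + K)%VS by rewrite aK memvf.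
  by case/memv_addP=> _ /vlineP[c ->] [k kK ->]; exists c, k.
have brE u c k : k \in K -> br u (c *: a + k) = c *: T u.
  by move=> /KP kK; rewrite linearDr linearZr_LR kK addr0 TE.
have cycT (U : {vspace L}) :
    (forall v, v \in U -> T v \in U) -> a \in U -> U = fullv.
  move=> UT aU; apply/vspaceP => v; rewrite memvf.
  have : generated_subalgebra br [set a] v by rewrite gena.
  apply; split; last by move=> _ ->.
  move=> x y xU _; have [c [k [kK ->]]] := decomp y.
  by rewrite brE // memvZ // UT.
have finT := finite_stable_subspaces cycT.
apply: (@sub_finite_set _ _ ([set K] `|` _)); last first.
  by rewrite finite_setU; split; [exact: finite_set1 | exact: finT].
move=> M [[subM properM] maxM].
have [MK|/subvPn[v vM vK]] := boolP (M <= K)%VS; last first.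
  right=> u uM; have [c [k [kK vE]]] := decomp v.
  have c0 : c != 0.
    by apply: contraNneq vK => c0; rewrite vE c0 scale0r add0r.
  (* br u v = c *: T u with c invertible, so T u is in M *)
  have := subM u v uM vM; rewrite vE brE // => /(memvZ c^-1).
  by rewrite scalerA mulVf // scale1r.
(* K itself is a subalgebra with zero product, so it equals M once proper *)
have [Kfull|Kproper] := eqVneq K fullv.
  right=> u uM; rewrite TE (KP a).1 ?mem0v //.
  by rewrite Kfull memvf.
left=> /=; apply: contrapT => MneK; apply: maxM; exists K; split=> //.
split; last exact/eqP.
by move=> x y _ /KP ->; rewrite mem0v.
Qed.

Lemma proper_subalgebra_maximal (U : {vspace L}) :
  proper_subalgebra br U ->
  exists2 M, maximal_subalgebra br M & (U <= M)%VS.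
Proof.
move=> Uprop.
pose Q n := `[< exists V : {vspace L},
  [/\ \dim V = n, proper_subalgebra br V & (U <= V)%VS] >].
have exQ : exists n, Q n.
  by exists (\dim U); apply/asboolP; exists U; rewrite subvv.
have ubQ n : Q n -> (n <= \dim {:L})%N.
  by move=> /asboolP[V [<- _ _]]; rewrite dimvS ?subvf.
case: (ex_maxnP exQ ubQ) => n /asboolP[M [dimM Mprop UM]] maxn.
exists M => //; split=> // -[V [Vprop MV]]; apply.
apply/eqP; rewrite eqEdim MV dimM maxn //; apply/asboolP.
by exists V; rewrite (subv_trans UM MV).
Qed.

End Leibniz.

(** Given [x] outside every member of [s] but inside [U], and [y] outside [U],
    the line [y + t *: x] never meets [U] and meets each member of [s] at most
    once, since the direction [x] is not in that member.  An infinite field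
    leaves a value of [t] outside these finitely many bad parameters. *)
Lemma avoid_finite_subspaces (F : fieldType) (L : vectType F)
    (s : seq {vspace L}) :
  infinite_set [set: F] -> (forall U, U \in s -> U <> fullv) ->
  exists x : L, forall U, U \in s -> x \notin U.
Proof.
move=> Finf; elim: s => [|U s IHs] sproper; first by exists 0.
have [|x xs] := IHs.
  by move=> V Vs; apply: sproper; rewrite in_cons Vs orbT.
have [xU|xU] := boolP (x \in U); last first.
  by exists x => V; rewrite in_cons => /predU1P[->|/xs].
have [y _ yU] : exists2 y, y \in {:L}%VS & y \notin U.
  apply/subvPn; apply/negP => fU; apply: (sproper U); rewrite ?mem_head //.
  by apply/eqP; rewrite eqEsubv subvf.
pose bad (V : {vspace L}) := xget 0 [set t : F | y + t *: x \in V].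
have badE V t : V \in s -> y + t *: x \in V -> t = bad V.
  move=> Vs yV; symmetry; apply: xget_unique => // t' yV'; apply/eqP.
  apply: contraTT (xs V Vs) => tt'; rewrite negbK.
  have := memvB yV' yV; rewrite opprD addrACA addrN add0r -scalerBl.
  move/(memvZ (t' - t)^-1); rewrite scalerA mulVf ?scale1r //.
  by rewrite subr_eq0.
have [t tbad] : exists t, t \notin map bad s.
  apply: contrapT => nex; apply: Finf; apply/finite_seqP.
  exists (map bad s); apply/seteqP; split=> // t _ /=.
  by apply: contrapT => /negP tb; apply: nex; exists t.
exists (y + t *: x) => V; rewrite in_cons => /predU1P[->|Vs].
  by rewrite rpredDr // memvZ.
apply: contra tbad => /(badE _ _ Vs) ->; exact: map_f.
Qed.

(** * The characterization of cyclic algebras *)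

Theorem corollary2p3 (F : fieldType) (L : vectType F)
  (br : {bilinear L -> L -> L}) (hF : infinite_set [set: F])
  (hL : right_leibniz br) :
  cyclic_algebra br <->
  finite_set [set M : {vspace L} | maximal_subalgebra br M].
Proof.
split; first exact: finite_maximal_of_cyclic.
move=> /finite_seqP[s sE].
have sP M : M \in s <-> maximal_subalgebra br M.
  by have := congr1 (fun A => A M) sE => /= ->.
have [|x xs] := @avoid_finite_subspaces F L s hF.
  by move=> M /sP[[]].
exists x; apply/seteqP; split=> // v _ U [subU xU].
apply: contrapT => vU.
have [|M /sP Ms UM] := @proper_subalgebra_maximal F L br U.
  by split=> // Ufull; apply: vU; rewrite Ufull /= memvf.
by move/negP: (xs M Ms); apply; apply: (subvP UM); exact: xU.
Qed.
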